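(* There exist absolute constants $c,C>0$ such that the following holds. Let $n\ge 6$, $d\ge1$, $\sigma>0$, consider the homoscedastic model $\sigma_1=\dots=\sigma_n=\sigma$, and let $$\kappa=2^{-5/2}\sigma\max\big\{(\log n)^{1/2},(c\,d\log n)^{1/4}\big\},\qquad \Theta_\kappa=\{\boldsymbol\theta\in(\mathbb R^d)^n:\ \kappa(\boldsymbol\theta)\ge\kappa\}.$$ Then $$\inf_{\hat\pi}\ \max_{\pi^*\in\mathfrak S_n}\ \sup_{\boldsymbol\theta\in\Theta_\kappa}\mathbf P_{\boldsymbol\theta,\boldsymbol\sigma,\pi^*}(\hat\pi\ne\pi^* )>C,$$ where the infimum is over all estimators $\hat\pi$ (measurable functions of the data with values in $\mathfrak S_n$).
   Context: Model: integers $n\ge2$, $d\ge1$. Unknown parameters: $\boldsymbol\theta=(\theta_1,\dots,\theta_n)$ with $\theta_i\in\mathbb R^d$, noise levels $\boldsymbol\sigma=(\sigma_1,\dots,\sigma_n)$ with $\sigma_i>0$, and a permutation $\pi^*\in\mathfrak S_n$ (the symmetric group on $\{1,\dots,n\}$). One observes $X_i=\theta_i+\sigma_i\xi_i$, $X_i^\#=\theta_{\pi^*(i)}+\sigma_i^\#\xi_i^\#$, $i=1,\dots,n$, where $\sigma_i^\#=\sigma_{\pi^*(i)}$ and $\xi_1,\dots,\xi_n,\xi_1^\#,\dots,\xi_n^\#$ are i.i.d. $\mathcal N(0,I_d)$. The law of the data is $\mathbf P_{\boldsymbol\theta,\boldsymbol\sigma,\pi^*}$. Separation distance: $\kappa(\boldsymbol\theta)=\min_{i\ne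 j}\|\theta_i-\theta_j\|$. *)

(* Defs.v *)
From HB Require Import structures.
From mathcomp Require Import all_boot all_order all_algebra all_fingroup.
From mathcomp Require Import all_classical all_reals all_analysis.
Set Implicit Arguments. Unset Strict Implicit. Unset Printing Implicit Defensive.
Import Order.TTheory GRing.Theory Num.Theory.
Local Open Scope classical_set_scope.
Local Open Scope ring_scope.

Section Defs.
Context {R : realType}.

Definition edist (d : nat) (u v : 'rV[R]_d) : R :=
  Num.sqrt (\sum_(k < d) (u 0 k - v 0 k) ^+ 2).

(* separation distance kappa(theta) = min_{i <> j} ||theta_i - theta_j||
   (for n >= 2 the set below is finite and nonempty, so inf = min) *)
Definition sep_dist (n d : nat) (theta : 'I_n -> 'rV[R]_d) : R :=
  inf [set r | exists i j : 'I_n, i != j /\ r = edist (theta i) (theta j)].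

(* Data space: (X_1..X_n, X#_1..X#_n), each X_i in R^d represented as a
   d-tuple of reals; it carries the product (= Borel) sigma-algebra. *)
Definition Data (n d : nat) := (n.-tuple (d.-tuple R) * n.-tuple (d.-tuple R))%type.

Definition estimator (n d : nat) (est : Data n d -> {perm 'I_n}) : Prop :=
  forall s : {perm 'I_n}, measurable (est @^-1` [set s]).

(* Iterated integral over N.-tuple T: coordinate k integrated with the
   functional I k (Fubini/Tonelli: for the product measure of the I k). *)
Fixpoint prodint {T : Type} (N : nat) :
  ('I_N -> (T -> \bar R) -> \bar R) -> (N.-tuple T -> \bar R) -> \bar R :=
  match N return ('I_N -> (T -> \bar R) -> \bar R) -> (N.-tuple T -> \bar R) -> \bar R with
  | 0 => fun _ f => f [tuple]
  | N'.+1 => fun I f =>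
      I ord0 (fun x => @prodint T N' (fun k => I (lift ord0 k))
                                    (fun t => f [tuple of x :: t]))
  end.

Definition gauss_int (m s : R) (g : R -> \bar R) : \bar R :=
  (\int[normal_prob m s]_x g x)%E.

Definition gauss_vec_int (d : nat) (mu : 'rV[R]_d) (s : R)
  (g : d.-tuple R -> \bar R) : \bar R :=
  prodint (fun k : 'I_d => gauss_int (mu 0 k) s) g.

(* Expectation under P_{theta, sigma, pi}: X_i ~ N(theta_i, sigma_i^2 I_d),
   X#_i ~ N(theta_{pi i}, sigma_{pi i}^2 I_d), all independent. *)
Definition law_expect (n d : nat) (theta : 'I_n -> 'rV[R]_d) (sigma : 'I_n -> R)
  (pi : {perm 'I_n}) (f : Data n d -> \bar R) : \bar R :=
  prodint (fun i : 'I_n => gauss_vec_int (theta i) (sigma i)) (fun X =>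
  prodint (fun i : 'I_n => gauss_vec_int (theta (pi i)) (sigma (pi i))) (fun Xs =>
  f (X, Xs))).

Definition prob_err (n d : nat) (theta : 'I_n -> 'rV[R]_d) (sigma : 'I_n -> R)
  (pi : {perm 'I_n}) (est : Data n d -> {perm 'I_n}) : \bar R :=
  law_expect theta sigma pi (fun z => ((est z != pi)%:R)%:E).

End Defs.

(* Main.v *)
(** Split the indices into the pairs (2k, 2k+1), and put independent uniform
    random signs on the pairs: coordinatewise, pair [k] is
    [delta * (4 k + e, 4 k - e)], so that all distances are at least
    [2 * delta * sqrt d = kappa].  An estimator chooses among the [n / 2]
    permutations exchanging one pair, and under the identity the decisions "swap
    pair [k]" are disjoint events, of average probability at most [1 / (n / 2)].  Under
    a centred pair, averaging over the signs turns the two likelihoods (swap [k],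
    identity) into the products over the [d] coordinates of [e^-b cosh u] and
    [e^-b cosh v], where [b = 2 delta^2 / sigma^2] and [u], [v] are uncorrelated
    Gaussian with [E e^(p u + q v) = e^(b (p^2 + q^2))].  Hence it suffices that the
    [d]-th power of [e^-b E (cosh^2 u / cosh v)] be at most [sqrt n].  For small [b]
    this expectation is [1 + O(b^2)], and in general it is at most [e^(3 b)]; these
    two bounds match the two terms in the maximum defining [kappa]. *)
Require Import Defs.
From HB Require Import structures.
From mathcomp Require Import all_boot all_order all_algebra all_fingroup.
From mathcomp Require Import all_classical all_reals all_analysis.
From mathcomp Require Import measurable_realfun.
From mathcomp Require Import ring lra.
Import Order.TTheory GRing.Theory Num.Theory.
Local Open Scope classical_set_scope.
Local Open Scope ring_scope.

(** * Densities and the Gaussian change of mean *)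

(** [g] integrates to [nu] on every measurable set, so it agrees almost everywhere with the
    Radon-Nikodym derivative, for which the change of variables is known. *)
Lemma ge0_integral_density d (T : measurableType d) (R : realType)
    (mu : {sigma_finite_measure set T -> \bar R})
    (nu : {finite_measure set T -> \bar R}) (g : T -> R) :
  measurable_fun setT g -> (forall x, 0 <= g x) ->
  (forall A, measurable A -> nu A = \int[mu]_(x in A) (g x)%:E)%E ->
  forall f : T -> \bar R, measurable_fun setT f -> (forall x, 0 <= f x)%E ->
  (\int[nu]_x f x = \int[mu]_x ((g x)%:E * f x))%E.
Proof.
move=> mg g0 nuE f mf f0.
have mgE : measurable_fun setT (EFin \o g) by exact/measurable_EFinP.
have numu : nu `<< mu.
  apply/null_content_dominatesP => A mA muA; rewrite nuE//.
  by apply: null_set_integral => //; exact: measurable_funTS.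
have iRN := Radon_Nikodym_SigmaFinite.f_integrable numu.
have mRN := measurable_int _ iRN.
rewrite -(Radon_Nikodym_SigmaFinite.change_of_variables numu)//.
under [RHS]eq_integral => x _ do rewrite muleC.
apply: ae_eq_integral => //; [exact: emeasurable_funM..|].
apply: ae_eqe_mul2l; apply: integral_ae_eq => // E _ mE.
by rewrite -Radon_Nikodym_SigmaFinite.f_integral// nuE.
Qed.

(** Likelihood ratio of N(m + a, s^2) against N(m, s^2) at [x]. *)
Definition gauss_lr {R : realType} (m s a x : R) : R :=
  expR (a * (x - m) / s ^+ 2 - a ^+ 2 / (s ^+ 2 *+ 2)).

Lemma gauss_lr_ge0 (R : realType) (m s a x : R) : 0 <= gauss_lr m s a x.
Proof. exact: expR_ge0. Qed.

Lemma measurable_gauss_lr (R : realType) (m s a : R) :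
  measurable_fun setT (gauss_lr m s a).
Proof.
apply: measurableT_comp => //; apply: measurable_funB => //.
by do 2 apply: measurable_funM => //; exact: measurable_funB.
Qed.

Lemma gauss_int_density (R : realType) (m s : R) (f : R -> \bar R) :
  measurable_fun setT f -> (forall x, 0 <= f x)%E ->
  (gauss_int m s f = \int[lebesgue_measure]_x ((normal_pdf m s x)%:E * f x))%E.
Proof.
move=> mf f0; apply: ge0_integral_density => //.
- exact: measurable_normal_pdf.
- by move=> x; exact: normal_pdf_ge0.
Qed.

Lemma gauss_int_shift (R : realType) (m s a : R) (f : R -> \bar R) : s != 0 ->
  measurable_fun setT f -> (forall x, 0 <= f x)%E ->
  (gauss_int (m + a) s f = gauss_int m s (fun x => (gauss_lr m s a x)%:E * f x))%E.
Proof.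
move=> s0 mf f0.
have mlr : measurable_fun setT (EFin \o gauss_lr m s a).
  by apply/measurable_EFinP; exact: measurable_gauss_lr.
rewrite gauss_int_density// gauss_int_density; last 2 first.
- exact: emeasurable_funM.
- by move=> x; rewrite mule_ge0// lee_fin gauss_lr_ge0.
apply: eq_integral => x _; rewrite muleA -EFinM; congr (_%:E * _)%E.
rewrite /normal_pdf (negbTE s0) /normal_fun /gauss_lr -[RHS]mulrA -expRD.
congr (_ * expR _); field; exact: s0.
Qed.

(* [prodint] iterates integrals without any measurability requirement; it is
   homogeneous, additive and monotone only through a representing measure. *)
Definition represented {d} {T : measurableType d} {R : realType}
    (I : (T -> \bar R) -> \bar R) : Prop :=
  exists P : probability T R, forall f, measurable_fun setT f ->
    (forall x, 0 <= f x)%E -> (I f = \int[P]_x f x)%E.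

(** [normal_prob] lives on [measurableTypeR R]; its image under the identity is a probability on [R]
    itself. *)
Lemma represented_gauss (R : realType) (m s : R) : represented (gauss_int m s).
Proof.
have mid : measurable_fun [set: measurableTypeR R] (fun x => x : R) by [].
pose idM := isMeasurableFun.Build _ _ _ _ (fun x : measurableTypeR R => x : R) mid.
pose H : {mfun measurableTypeR R >-> R} := HB.pack (fun x : measurableTypeR R => x : R) idM.
exists (distribution (normal_prob m s) H) => f mf f0.
by rewrite ge0_integral_distribution.
Qed.

(** * Functionals represented by a probability, and iterated integrals *)

Section represented_theory.
Context {d} {T : measurableType d} {R : realType}.
Implicit Types (I : (T -> \bar R) -> \bar R).

Lemma represented_ge0 I (f : T -> \bar R) : represented I -> measurable_fun setT f ->
  (forall x, 0 <= f x)%E -> (0 <= I f)%E.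
Proof. by move=> [P IP] mf f0; rewrite IP//; exact: integral_ge0. Qed.

Lemma representedZl I (f : T -> \bar R) (k : R) : represented I -> measurable_fun setT f ->
  (forall x, 0 <= f x)%E -> 0 <= k -> (I (fun x => k%:E * f x) = k%:E * I f)%E.
Proof.
move=> [P IP] mf f0 k0; rewrite !IP ?ge0_integralZl//.
- exact: measurable_funeM.
- by move=> x; rewrite mule_ge0.
Qed.

Lemma measurable_represented {d1} {S : measurableType d1} I (f : S * T -> \bar R) :
  represented I -> measurable_fun setT f -> (forall x, 0 <= f x)%E ->
  measurable_fun setT (fun x => I (fun y => f (x, y))).
Proof.
move=> [P IP] mf f0.
rewrite [X in measurable_fun _ X](_ : _ = fubini_F P f).
  exact: measurable_fun_fubini_tonelli_F.
by apply/funext => x; rewrite IP// ; apply: measurableT_comp.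
Qed.

End represented_theory.

(** By Tonelli, the image of the product measure under [h] represents [K]. A general [h] covers both
    the consing of tuples and the pairing of the two samples. *)
Lemma represented_comp {d} {T : measurableType d} {R : realType} {d1} {S : measurableType d1} {d2} {U : measurableType d2}
    (I : (T -> \bar R) -> \bar R) (J : (S -> \bar R) -> \bar R) (h : T * S -> U) (K : (U -> \bar R) -> \bar R) :
  represented I -> represented J -> measurable_fun setT h ->
  (forall f : U -> \bar R, measurable_fun setT f -> (forall x, 0 <= f x)%E ->
    K f = I (fun x => J (fun y => f (h (x, y))))) ->
  represented K.
Proof.
move=> [P IP] [Q JQ] mh KE.
pose hM := isMeasurableFun.Build _ _ _ _ h mh.
pose H : {mfun (T * S)%type >-> U} := HB.pack h hM.
exists (distribution (P \x Q)%E H) => f mf f0.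
have mfh : measurable_fun setT (f \o h) by exact: measurableT_comp.
rewrite KE// ge0_integral_distribution// fubini_tonelli1//; last by move=> x /=.
rewrite IP; last 2 first.
- apply: (measurable_represented J (f \o h)) => //; first by exists Q.
  by move=> x /=.
- move=> x; apply: (represented_ge0 J); first by exists Q.
    by apply: (measurableT_comp mfh); exact: pair1_measurable.
  by move=> y.
apply: eq_integral => x _; rewrite JQ//.
by apply: (measurableT_comp mfh); exact: pair1_measurable.
Qed.

Section prodint_theory.
Context {d} {T : measurableType d} {R : realType}.

Lemma measurable_tuple_cons N :
  measurable_fun setT (fun z : T * N.-tuple T => [tuple of z.1 :: z.2]).
Proof. by apply: measurable_cons; [exact: measurable_fst|exact: measurable_snd]. Qed.

Lemma represented_prodint N (I : 'I_N -> (T -> \bar R) -> \bar R) :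
  (forall k, represented (I k)) -> represented (prodint I).
Proof.
elim: N I => [|N IH] I rI.
  exists (dirac [tuple] : probability _ _) => f mf f0.
  by rewrite integral_dirac//= diracT mul1e.
apply: (represented_comp (I ord0) (prodint (fun k => I (lift ord0 k)))
  (fun z : T * N.-tuple T => [tuple of z.1 :: z.2])) => //.
- by apply: IH => k.
- exact: measurable_tuple_cons.
Qed.

(** Product measures have product densities: peel off the first coordinate and move its density
    inside the inner integral by homogeneity. It serves twice, for the coordinates of a vector and
    for the vectors of a sample. *)
Lemma prodint_density N (I J : 'I_N -> (T -> \bar R) -> \bar R) (L : 'I_N -> T -> R) :
  (forall k, represented (I k)) -> (forall k, represented (J k)) ->
  (forall k, measurable_fun setT (L k)) -> (forall k x, 0 <= L k x) ->
  (forall k f, measurable_fun setT f -> (forall x, 0 <= f x)%E ->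
    J k f = I k (fun x => (L k x)%:E * f x)%E) ->
  forall f, measurable_fun setT f -> (forall x, 0 <= f x)%E ->
  prodint J f = prodint I (fun t => (\prod_k L k (tnth t k))%:E * f t)%E.
Proof.
elim: N I J L => [|N IH] I J L rI rJ mL L0 JE f mf f0 /=.
  by rewrite big_ord0 mul1e.
have mfc : measurable_fun setT (fun z : T * N.-tuple T => f [tuple of z.1 :: z.2]).
  by apply: (measurableT_comp mf); exact: measurable_tuple_cons.
have rI' : represented (prodint (fun k => I (lift ord0 k))) by exact: represented_prodint.
have rJ' : represented (prodint (fun k => J (lift ord0 k))) by exact: represented_prodint.
rewrite JE; last 2 first.
- exact: (measurable_represented _ (fun z : T * N.-tuple T => f [tuple of z.1 :: z.2])).
- move=> x; apply: (represented_ge0 (prodint _)) => //.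
  exact: (measurable_fun_pair2 x mfc).
congr (I ord0 _); apply/funext => x.
have mfx : measurable_fun setT (fun t : N.-tuple T => f [tuple of x :: t]).
  exact: (measurable_fun_pair2 x mfc).
rewrite (IH (fun k => I (lift ord0 k)) _ (fun k => L (lift ord0 k)))//; last first.
  by move=> k f1 mf1 f10; exact: JE.
rewrite -representedZl//; last 2 first.
- apply: emeasurable_funM => //; apply/measurable_EFinP.
  apply: measurable_prod => k _; apply: measurableT_comp => //.
  exact: measurable_tnth.
- by move=> t; rewrite mule_ge0// lee_fin prodr_ge0.
congr prodint; apply/funext => t.
rewrite big_ord_recl /= muleA -EFinM; congr (_%:E * _)%E; congr (_ * _).
by apply: eq_bigr => i _; rewrite tnthS.
Qed.

End prodint_theory.

(** * Mixtures over random signs *)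

Definition coshR {R : realType} (x : R) : R := (expR x + expR (- x)) / 2.

Lemma coshR_ge1 (R : realType) (x : R) : 1 <= coshR x.
Proof.
have e0 := expR_gt0 x; rewrite /coshR expRN.
rewrite -subr_ge0 (_ : _ - 1 = (expR x - 1) ^+ 2 / (2 * expR x)).
  by rewrite divr_ge0 ?sqr_ge0// mulr_ge0// ltW.
by field; rewrite gt_eqF.
Qed.

Lemma Rintegral_sum d (T : measurableType d) (R : realType)
    (mu : {measure set T -> \bar R}) (J : finType) (f : J -> T -> R) :
  (forall j, mu.-integrable setT (EFin \o f j)) ->
  \int[mu]_x (\sum_j f j x) = \sum_j \int[mu]_x f j x.
Proof.
move=> fi; rewrite /Rintegral.
under eq_integral => x _ do rewrite -sumEFin.
rewrite integral_sum// -sum_fine// => j _.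
exact: (integrable_fin_num measurableT (fi j)).
Qed.

Lemma integrable_EFin_sum d (T : measurableType d) (R : realType)
    (mu : {measure set T -> \bar R}) (J : finType) (f : J -> T -> R) :
  (forall j, mu.-integrable setT (EFin \o f j)) ->
  mu.-integrable setT (EFin \o (fun x => \sum_j f j x)).
Proof.
move=> fi; rewrite (_ : EFin \o _ = fun x => (\sum_j (f j x)%:E)%E).
  by apply: integrable_sum => // j _; exact: fi.
by apply/funext => x /=; rewrite sumEFin.
Qed.

Section sign_mixture.
Context {disp : measure_display} {T : measurableType disp} {R : realType}.
Variables (P : probability T R) (d : nat) (u v : 'I_d -> T -> R) (beta : R).
Hypothesis mu_ : forall k, measurable_fun setT (u k).
Hypothesis mv_ : forall k, measurable_fun setT (v k).

Definition tilt (p q : 'I_d -> R) (x : T) : R :=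
  expR (\sum_k (p k * u k x + q k * v k x - beta * (p k ^+ 2 + q k ^+ 2))).

Lemma measurable_tilt p q : measurable_fun setT (tilt p q).
Proof.
apply: measurableT_comp => //; apply: measurable_sum => k.
by apply: measurable_funB => //; apply: measurable_funD; apply: measurable_funM.
Qed.

(** The moment generating function of independent centred Gaussians [u k], [v k] of variance 2 beta.
    This is the only distributional input of the section: each [tilt p q] is a probability
    density. *)
Hypothesis tilt1 : forall p q, (\int[P]_x (tilt p q x)%:E = 1)%E.

Lemma integrable_tilt p q : P.-integrable setT (EFin \o tilt p q).
Proof.
apply/integrableP; split; first by apply/measurable_EFinP; exact: measurable_tilt.
under eq_integral => x _ do rewrite /= ger0_norm ?expR_ge0//.
by rewrite tilt1 ltry.
Qed.

Lemma integrable_tilt_indic p q A : measurable A ->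
  P.-integrable setT (EFin \o (fun x => tilt p q x * \1_A x)).
Proof.
move=> mA; apply: le_integrable (integrable_tilt p q) => //.
  apply/measurable_EFinP; apply: measurable_funM => //; exact: measurable_tilt.
move=> x _ /=; rewrite lee_fin normrM ler_piMr// indicE.
by case: (x \in A); rewrite ?normr1 ?normr0.
Qed.

Definition sg (e : bool) : R := if e then 1 else -1.

Lemma tilt_prod p q x : tilt p q x =
  \prod_k expR (p k * u k x + q k * v k x - beta * (p k ^+ 2 + q k ^+ 2)).
Proof. by rewrite /tilt expR_sum. Qed.

(** Distributivity turns the sum over sign vectors into a product over coordinates, where the two
    signs add up to a hyperbolic cosine. *)
Lemma sum_tilt_u x : \sum_(eta : {ffun 'I_d -> bool}) tilt (sg \o eta) (fun=> 0) x =
  2 ^+ d * \prod_k (expR (- beta) * coshR (u k x)).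
Proof.
rewrite (eq_bigr _ (fun eta _ => tilt_prod _ _ x)) /=.
rewrite -(bigA_distr_bigA (fun k e => expR (sg e * u k x + 0 * v k x - beta * (sg e ^+ 2 + 0 ^+ 2)))).
have -> : 2 ^+ d = \prod_(k < d) 2 :> R by rewrite prodr_const card_ord.
rewrite -big_split /=; apply: eq_bigr => k _.
rewrite big_bool /= /coshR.
transitivity (expR (- beta) * (expR (u k x) + expR (- u k x))); last by field.
by rewrite [RHS]mulrDr -!expRD; congr (expR _ + expR _); ring.
Qed.

Lemma sum_tilt_v x : \sum_(eta : {ffun 'I_d -> bool}) tilt (fun=> 0) (sg \o eta) x =
  2 ^+ d * \prod_k (expR (- beta) * coshR (v k x)).
Proof.
rewrite (eq_bigr _ (fun eta _ => tilt_prod _ _ x)) /=.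
rewrite -(bigA_distr_bigA (fun k e => expR (0 * u k x + sg e * v k x - beta * (0 ^+ 2 + sg e ^+ 2)))).
have -> : 2 ^+ d = \prod_(k < d) 2 :> R by rewrite prodr_const card_ord.
rewrite -big_split /=; apply: eq_bigr => k _.
rewrite big_bool /= /coshR.
transitivity (expR (- beta) * (expR (v k x) + expR (- v k x))); last by field.
by rewrite [RHS]mulrDr -!expRD; congr (expR _ + expR _); ring.
Qed.

(** The ratio cosh^2 x / cosh y is dominated by a finite combination of exponentials, whose
    expectations [tilt1] computes. The coefficients [c] may be negative. *)
Variables (J : finType) (c a b : J -> R).
Hypothesis cosh_le : forall x y : R,
  coshR x ^+ 2 <= coshR y * \sum_j c j * expR (a j * x + b j * y).

(** If p1 and p0 are the sign-averaged densities, [H] dominates p1^2 / p0, and [G] is the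
    expectation of one factor of [H]; so G^d bounds one plus the chi-square divergence. *)
Let G := expR (- beta) * \sum_j c j * expR (beta * (a j ^+ 2 + b j ^+ 2)).
Let H x := \prod_k (expR (- beta) * \sum_j c j * expR (a j * u k x + b j * v k x)).

Lemma chi2_expand x : H x = \sum_(phi : {ffun 'I_d -> J})
  (\prod_k (expR (- beta) * (c (phi k) * expR (beta * (a (phi k) ^+ 2 + b (phi k) ^+ 2))))) *
  tilt (a \o phi) (b \o phi) x.
Proof.
rewrite /H; under eq_bigr => k _ do rewrite big_distrr /=.
rewrite bigA_distr_bigA; apply: eq_bigr => phi _.
rewrite tilt_prod -big_split /=; apply: eq_bigr => k _.
rewrite -!mulrA -expRD; congr (_ * (_ * expR _)); ring.
Qed.

Lemma integrable_chi2 : P.-integrable setT (EFin \o H).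
Proof.
rewrite (funext chi2_expand); apply: integrable_EFin_sum => phi.
exact: (integrableZl measurableT _ (integrable_tilt _ _)).
Qed.

Lemma Rintegral_chi2 : \int[P]_x H x = G ^+ d.
Proof.
under eq_Rintegral => x _ do rewrite chi2_expand.
rewrite Rintegral_sum; last first.
  move=> phi; apply: (integrableZl measurableT _ (integrable_tilt _ _)).
have -> : G ^+ d = \prod_(k < d) G by rewrite prodr_const card_ord.
rewrite /G.
under [RHS]eq_bigr => k _ do rewrite big_distrr /=.
rewrite bigA_distr_bigA; apply: eq_bigr => phi _.
rewrite RintegralZl//; last exact: integrable_tilt.
by rewrite /Rintegral tilt1 mulr1.
Qed.

(** AM-GM gives p1 <= (t / 2) p0 + (p1^2 / p0) / (2 t); the first term is integrated over [A], the
    second is enlarged to the whole space. With [t] the number of pairs, the first terms will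
    average to at most 1/2 over disjoint events. *)
Lemma sign_mixture_bound (A : set T) (t : R) : measurable A -> 0 < t ->
  \sum_(eta : {ffun 'I_d -> bool}) \int[P]_x (tilt (sg \o eta) (fun=> 0) x * \1_A x) <=
  t / 2 * \sum_(eta : {ffun 'I_d -> bool}) \int[P]_x (tilt (fun=> 0) (sg \o eta) x * \1_A x)
  + 2 ^+ d * (G ^+ d / (2 * t)).
Proof.
move=> mA t0.
have iA p q := integrable_tilt_indic p q A mA.
have iu := integrable_EFin_sum _ _ _ P _ _
  (fun eta : {ffun 'I_d -> bool} => iA (sg \o eta) (fun=> 0)).
have iv := integrable_EFin_sum _ _ _ P _ _
  (fun eta : {ffun 'I_d -> bool} => iA (fun=> 0) (sg \o eta)).
have iv' := integrableZl measurableT (t / 2) iv.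
have iH' := integrableZl measurableT (2 ^+ d / (2 * t)) integrable_chi2.
rewrite -!Rintegral_sum//.
rewrite -RintegralZl// -Rintegral_chi2 mulrA [X in _ + X]mulrAC.
rewrite -RintegralZl//; last exact: integrable_chi2.
rewrite -RintegralD//; apply: le_Rintegral => //.
  exact: (integrableD measurableT iv' iH').
move=> x _; rewrite -!mulr_suml sum_tilt_u sum_tilt_v.
set p1 := \prod_k _; set p0 := \prod_k _.
have p10 : 0 <= p1.
  by apply: prodr_ge0 => k _; rewrite mulr_ge0 ?expR_ge0 ?(le_trans ler01) ?coshR_ge1.
have p00 : 0 <= p0.
  by apply: prodr_ge0 => k _; rewrite mulr_ge0 ?expR_ge0 ?(le_trans ler01) ?coshR_ge1.
have pH : p1 ^+ 2 <= p0 * H x.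
  rewrite /p1 /p0 /H -prodrXl -big_split /=; apply: ler_prod => k _.
  by rewrite sqr_ge0 /= exprMn [leRHS]mulrACA -expr2 ler_wpM2l ?sqr_ge0.
(* As [c] may be negative, the sign of a factor is read off [cosh_le]: multiplied by a positive cosh
   it dominates a square. *)
have H0 : 0 <= H x.
  apply: prodr_ge0 => k _; rewrite mulr_ge0 ?expR_ge0//.
  rewrite -(pmulr_rge0 _ (lt_le_trans ltr01 (coshR_ge1 _ (v k x)))).
  by apply: le_trans (cosh_le _ _); exact: sqr_ge0.
(* [p1 <= sqrt (p0 * H x)], then AM-GM *)
have amgm : p1 <= t / 2 * p0 + H x / (2 * t).
  rewrite -(@ler_pXn2r _ 2)// ?nnegrE; last first.
    by rewrite addr_ge0// ?mulr_ge0 ?invr_ge0 ?mulr_ge0// ltW.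
  apply: (le_trans pH); rewrite -subr_ge0.
  rewrite (_ : _ - _ = (t / 2 * p0 - H x / (2 * t)) ^+ 2) ?sqr_ge0//.
  by field; rewrite gt_eqF.
rewrite indicE; case: (x \in A); rewrite /= ?mulr0 ?mulr1; last first.
  by rewrite add0r mulr_ge0// divr_ge0// ?exprn_ge0// mulr_ge0// ltW.
rewrite (_ : _ + _ = 2 ^+ d * (t / 2 * p0 + H x / (2 * t))).
  by rewrite ler_wpM2l ?exprn_ge0.
by rewrite /p0; field; rewrite gt_eqF.
Qed.
End sign_mixture.

(** * The law of two independent Gaussian samples *)

Section pair_law.
Context {R : realType} {n d : nat}.
Implicit Types (mu nu a b : 'I_n -> 'rV[R]_d) (s : R) (f : @Data R n d -> \bar R).

Definition vec_lr (s : R) (m w : 'rV[R]_d) (x : d.-tuple R) : R :=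
  \prod_k gauss_lr (m 0 k) s (w 0 k) (tnth x k).

Lemma vec_lr_ge0 s m w x : 0 <= vec_lr s m w x.
Proof. by apply: prodr_ge0 => k _; exact: gauss_lr_ge0. Qed.

Lemma measurable_vec_lr s m w : measurable_fun setT (vec_lr s m w).
Proof.
apply: measurable_prod => k _; apply: measurableT_comp; last exact: measurable_tnth.
exact: measurable_gauss_lr.
Qed.

Lemma represented_gauss_vec (m : 'rV[R]_d) s : represented (gauss_vec_int m s).
Proof. by apply: represented_prodint => k; exact: represented_gauss. Qed.

Lemma gauss_vec_shift (m w : 'rV[R]_d) s (f : d.-tuple R -> \bar R) : s != 0 ->
  measurable_fun setT f -> (forall x, 0 <= f x)%E ->
  gauss_vec_int (m + w) s f =
  gauss_vec_int m s (fun x => (vec_lr s m w x)%:E * f x)%E.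
Proof.
move=> s0 mf f0.
have JE k (g : R -> \bar R) : measurable_fun setT g -> (forall x, 0 <= g x)%E ->
    gauss_int ((m + w) 0 k) s g =
    gauss_int (m 0 k) s (fun x => (gauss_lr (m 0 k) s (w 0 k) x)%:E * g x)%E.
  by move=> mg g0; rewrite mxE gauss_int_shift.
exact: (prodint_density _ _ _ _ (fun k => represented_gauss _ (m 0 k) s)
  (fun k => represented_gauss _ ((m + w) 0 k) s)
  (fun k => measurable_gauss_lr _ (m 0 k) s (w 0 k))
  (fun k x => gauss_lr_ge0 _ (m 0 k) s (w 0 k) x) JE f mf f0).
Qed.

(* [law_expect theta (fun=> s) pi] is convertible to
   [pair_law theta (theta \o pi) s]. *)
Definition pair_law mu nu s f : \bar R :=
  prodint (fun i : 'I_n => gauss_vec_int (mu i) s) (fun X =>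
  prodint (fun i : 'I_n => gauss_vec_int (nu i) s) (fun Xs => f (X, Xs))).

Definition sample_lr s mu a (X : n.-tuple (d.-tuple R)) : R :=
  \prod_i vec_lr s (mu i) (a i) (tnth X i).

Lemma sample_lr_ge0 s mu a X : 0 <= sample_lr s mu a X.
Proof. by apply: prodr_ge0 => k _; exact: vec_lr_ge0. Qed.

Lemma measurable_sample_lr s mu a : measurable_fun setT (sample_lr s mu a).
Proof.
apply: measurable_prod => k _; apply: measurableT_comp; last exact: measurable_tnth.
exact: measurable_vec_lr.
Qed.

Lemma represented_sample mu s :
  represented (prodint (fun i : 'I_n => gauss_vec_int (mu i) s)).
Proof. by apply: represented_prodint => k; exact: represented_gauss_vec. Qed.

Lemma represented_pair_law mu nu s : represented (pair_law mu nu s).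
Proof.
exact: (represented_comp _ _ (fun z => z) _ (represented_sample mu s) (represented_sample nu s)).
Qed.

Lemma sample_shift mu a s (f : n.-tuple (d.-tuple R) -> \bar R) : s != 0 ->
  measurable_fun setT f -> (forall x, 0 <= f x)%E ->
  prodint (fun i => gauss_vec_int (mu i + a i) s) f =
  prodint (fun i => gauss_vec_int (mu i) s) (fun X => (sample_lr s mu a X)%:E * f X)%E.
Proof.
move=> s0 mf f0.
exact: (prodint_density _ _ _ _ (fun i => represented_gauss_vec (mu i) s)
  (fun i => represented_gauss_vec (mu i + a i) s)
  (fun i => measurable_vec_lr s (mu i) (a i))
  (fun i x => vec_lr_ge0 s (mu i) (a i) x)
  (fun i g mg g0 => gauss_vec_shift (mu i) (a i) s g s0 mg g0) f mf f0).
Qed.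

Lemma pair_law_shift mu nu a b s f : s != 0 ->
  measurable_fun setT f -> (forall x, 0 <= f x)%E ->
  pair_law (fun i => mu i + a i) (fun i => nu i + b i) s f =
  pair_law mu nu s
    (fun z => (sample_lr s mu a z.1 * sample_lr s nu b z.2)%:E * f z)%E.
Proof.
move=> s0 mf f0; rewrite /pair_law.
have mb : measurable_fun setT (fun z : @Data R n d => (sample_lr s nu b z.2)%:E * f z)%E.
  apply: emeasurable_funM => //; apply/measurable_EFinP.
  by apply: measurableT_comp; [exact: measurable_sample_lr|exact: measurable_snd].
have b0 (z : @Data R n d) : (0 <= (sample_lr s nu b z.2)%:E * f z)%E.
  by rewrite mule_ge0// lee_fin sample_lr_ge0.
pose g X := prodint (fun i => gauss_vec_int (nu i) s)
  (fun Xs => (sample_lr s nu b Xs)%:E * f (X, Xs))%E.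
have gE X : prodint (fun i => gauss_vec_int (nu i + b i) s) (fun Xs => f (X, Xs)) = g X.
  exact: (sample_shift nu b s _ s0 (measurable_fun_pair2 X mf) (fun Xs => f0 (X, Xs))).
have mg : measurable_fun setT g.
  exact: (measurable_represented _ _ (represented_sample nu s) mb b0).
have g0 X : (0 <= g X)%E.
  exact: (represented_ge0 _ _ (represented_sample nu s)
    (measurable_fun_pair2 X mb) (fun Xs => b0 (X, Xs))).
apply: (etrans (congr1 (prodint _) (funext gE))).
apply: (etrans (sample_shift mu a s g s0 mg g0)).
apply: congr1; apply/funext => X.
apply: (etrans (esym (representedZl _ _ _ (represented_sample nu s)
  (measurable_fun_pair2 X mb) (fun Xs => b0 (X, Xs)) (sample_lr_ge0 s mu a X)))).
by apply: congr1; apply/funext => Xs; rewrite /= muleA -EFinM.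
Qed.

(** Deviation of a pair from its midpoint: exchanging the two points amounts to replacing [w] by its
    opposite. *)
Definition dipole (i1 i2 : 'I_n) (w : 'rV[R]_d) (i : 'I_n) : 'rV[R]_d :=
  ((i == i1)%:R - (i == i2)%:R) *: w.

(** With a common mean at [i1] and [i2] the terms in [mu] cancel, so only the difference of the two
    observations remains. *)
Lemma sample_lr_dipole s mu (i1 i2 : 'I_n) w X : i1 != i2 -> mu i1 = mu i2 ->
  sample_lr s mu (dipole i1 i2 w) X =
  \prod_k expR (w 0 k * (tnth (tnth X i1) k - tnth (tnth X i2) k) / s ^+ 2 -
                w 0 k ^+ 2 / s ^+ 2).
Proof.
move=> i12 mu12; rewrite /sample_lr (bigD1 i1)//= (bigD1 i2) 1?eq_sym//=.
rewrite big1 ?mulr1; last first.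
  move=> i /andP[/negbTE i1i /negbTE i2i]; rewrite /vec_lr big1// => k _.
  rewrite /gauss_lr /dipole i1i i2i mxE subrr !mul0r expr0n/= mul0r subrr.
  exact: expR0.
rewrite /vec_lr -big_split /=; apply: eq_bigr => k _.
rewrite /gauss_lr /dipole !eqxx (negbTE i12) eq_sym (negbTE i12) !mxE -expRD mu12 /=.
congr expR; have [->|s0] := eqVneq s 0; last by field.
by rewrite expr0n /= mul0rn !invr0 !mulr0 !subrr addr0.
Qed.

End pair_law.

(** * Likelihoods inside one pair *)

Section block.
Context {R : realType} {n d : nat}.
Variables (s delta : R) (B : 'I_n -> 'rV[R]_d) (i1 i2 : 'I_n).
Hypotheses (s0 : s != 0) (i12 : i1 != i2) (B12 : B i1 = B i2).

Let beta := 2 * delta ^+ 2 / s ^+ 2.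

Definition vdiff (X : n.-tuple (d.-tuple R)) (k : 'I_d) : R :=
  tnth (tnth X i1) k - tnth (tnth X i2) k.

Lemma measurable_vdiff k : measurable_fun setT (vdiff ^~ k).
Proof.
apply: measurable_funB;
  by apply: (measurableT_comp (measurable_tnth k)); exact: measurable_tnth.
Qed.

(** [P] is the law with the pair collapsed to its midpoint; [u] and [v] are the scaled difference
    and sum of the within-pair gaps of the two samples. The quadratic terms add up to beta (p^2 +
    q^2) because (p + q)^2 + (q - p)^2 = 2 (p^2 + q^2). Thus [q = 0] is the swapped pair and [p = 0]
    the unswapped one. *)
Lemma pair_law_tilt : exists (P : probability (@Data R n d) R) (u v : 'I_d -> @Data R n d -> R),
  [/\ forall k, measurable_fun setT (u k), forall k, measurable_fun setT (v k) &
   forall (p q : 'I_d -> R) (f : @Data R n d -> \bar R),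
     measurable_fun setT f -> (forall z, 0 <= f z)%E ->
     pair_law (fun i => B i + dipole i1 i2 (\row_k (delta * (p k + q k))) i)
              (fun i => B i + dipole i1 i2 (\row_k (delta * (q k - p k))) i) s f =
     (\int[P]_z ((tilt d u v beta p q z)%:E * f z))%E].
Proof.
have [P PE] := represented_pair_law B B s.
exists P, (fun k z => delta / s ^+ 2 * (vdiff z.1 k - vdiff z.2 k)),
  (fun k z => delta / s ^+ 2 * (vdiff z.1 k + vdiff z.2 k)).
have m1 k : measurable_fun setT (fun z : @Data R n d => vdiff z.1 k).
  by apply: (measurableT_comp (measurable_vdiff k)); exact: measurable_fst.
have m2 k : measurable_fun setT (fun z : @Data R n d => vdiff z.2 k).
  by apply: (measurableT_comp (measurable_vdiff k)); exact: measurable_snd.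
have mu_ k : measurable_fun setT
    (fun z : @Data R n d => delta / s ^+ 2 * (vdiff z.1 k - vdiff z.2 k)).
  by apply: measurable_funM => //; exact: measurable_funB.
have mv_ k : measurable_fun setT
    (fun z : @Data R n d => delta / s ^+ 2 * (vdiff z.1 k + vdiff z.2 k)).
  by apply: measurable_funM => //; exact: measurable_funD.
split => // p q f mf f0.
rewrite pair_law_shift// PE; last 2 first.
- apply: emeasurable_funM => //; apply/measurable_EFinP; apply: measurable_funM.
    by apply: (measurableT_comp (measurable_sample_lr _ _ _)); exact: measurable_fst.
  by apply: (measurableT_comp (measurable_sample_lr _ _ _)); exact: measurable_snd.
- by move=> z; rewrite mule_ge0// lee_fin mulr_ge0 ?sample_lr_ge0.
apply: eq_integral => z _; congr (_%:E * _)%E.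
rewrite !sample_lr_dipole// tilt_prod -big_split /=; apply: eq_bigr => k _.
by rewrite -expRD; congr expR; rewrite !mxE /beta /vdiff; field.
Qed.

Definition signs (eta : {ffun 'I_d -> bool}) : 'rV[R]_d := \row_k (delta * sg (eta k)).

Lemma block_bound (J : finType) (c a b : J -> R) (A : set (@Data R n d)) (t : R) :
  (forall x y : R, coshR x ^+ 2 <= coshR y * \sum_j c j * expR (a j * x + b j * y)) ->
  measurable A -> 0 < t ->
  \sum_eta fine (pair_law (fun i => B i + dipole i1 i2 (signs eta) i)
    (fun i => B i + dipole i1 i2 (- signs eta) i) s (EFin \o \1_A)) <=
  t / 2 * \sum_eta fine (pair_law (fun i => B i + dipole i1 i2 (signs eta) i)
    (fun i => B i + dipole i1 i2 (signs eta) i) s (EFin \o \1_A)) +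
  2 ^+ d * ((expR (- beta) * \sum_j c j * expR (beta * (a j ^+ 2 + b j ^+ 2))) ^+ d / (2 * t)).
Proof.
move=> hc mA t0.
have [P [u [v [mu_ mv_ PE]]]] := pair_law_tilt.
have mI : measurable_fun setT (EFin \o \1_A : @Data R n d -> \bar R).
  by apply/measurable_EFinP; exact: measurable_indic.
have I0 z : (0 <= (EFin \o \1_A : @Data R n d -> \bar R) z)%E by rewrite lee_fin.
(* The case f = 1 of [PE]: the shifted law has total mass one. *)
have tilt1 p q : (\int[P]_z (tilt d u v beta p q z)%:E = 1)%E.
  have := PE p q (cst 1%E) (measurable_cst _) (fun=> lee01).
  under eq_integral => z _ do rewrite mule1.
  move=> <-.
  have [Q ->//] := represented_pair_law
    (fun i => B i + dipole i1 i2 (\row_k (delta * (p k + q k))) i)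
    (fun i => B i + dipole i1 i2 (\row_k (delta * (q k - p k))) i) s.
  by rewrite integral_cst// mul1e; exact: probability_setT.
have lawE p q w w' : w = \row_k (delta * (p k + q k)) ->
    w' = \row_k (delta * (q k - p k)) ->
    fine (pair_law (fun i => B i + dipole i1 i2 w i) (fun i => B i + dipole i1 i2 w' i)
      s (EFin \o \1_A)) = \int[P]_z (tilt d u v beta p q z * \1_A z).
  by move=> -> ->; rewrite (PE p q _ mI I0).
have uE eta : fine (pair_law (fun i => B i + dipole i1 i2 (signs eta) i)
    (fun i => B i + dipole i1 i2 (- signs eta) i) s (EFin \o \1_A)) =
    \int[P]_z (tilt d u v beta (sg \o eta) (fun=> 0) z * \1_A z).
  by apply: lawE; apply/rowP => k; rewrite !mxE ?addr0 ?sub0r ?mulrN.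
have vE eta : fine (pair_law (fun i => B i + dipole i1 i2 (signs eta) i)
    (fun i => B i + dipole i1 i2 (signs eta) i) s (EFin \o \1_A)) =
    \int[P]_z (tilt d u v beta (fun=> 0) (sg \o eta) z * \1_A z).
  by apply: lawE; apply/rowP => k; rewrite !mxE ?add0r ?subr0.
have subst_le (x x' y y' e f : R) : x = x' -> y = y' -> x' <= e * y' + f -> x <= e * y + f.
  by move=> -> ->.
exact: (subst_le _ _ _ _ _ _ (eq_bigr _ (fun eta _ => uE eta))
  (eq_bigr _ (fun eta _ => vE eta))
  (sign_mixture_bound P d u v beta mu_ mv_ tilt1 J c a b hc A t mA t0)).
Qed.

End block.

(** * Averaging over the configurations *)

Section resample.
Context {I E : finType}.

Definition upd (eps : {ffun I -> E}) (k : I) (eta : E) : {ffun I -> E} :=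
  [ffun i => if i == k then eta else eps i].

(* [(eps, eta) |-> (upd eps k eta, eps k)] is an involution. *)
Lemma sum_resample (R : realType) (k : I) (F : {ffun I -> E} -> R) :
  \sum_eps \sum_eta F (upd eps k eta) = #|E|%:R * \sum_eps F eps.
Proof.
rewrite pair_big /=; pose h (x : {ffun I -> E} * E) := (upd x.1 k x.2, x.1 k).
have hK : involutive h.
  move=> [eps eta]; rewrite /h /=; congr (_, _); last by rewrite ffunE eqxx.
  by apply/ffunP => i; rewrite !ffunE; case: eqP => [->|].
rewrite (reindex_inj (inv_inj hK)) /=.
rewrite (eq_bigr (fun x => F x.1)); last by move=> x _; have /= := congr1 fst (hK x) => ->.
rewrite -(pair_big predT predT (fun eps _ => F eps)) /= mulr_sumr.
by apply: eq_bigr => eps _; rewrite sumr_const mulr_natl.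
Qed.

(** Resampling one block preserves the uniform law on [eps], so averaging [step] over [eps] bounds
    the mean of [F] at [k] by m / 2 times the mean of [H] at [k], plus [D]. Averaging over the [m]
    values of [k], the sums of [H] being at most 1, leaves 1/2 + D. *)
Lemma resampling_average (R : realType) (m : nat) (blk : 'I_m -> I)
    (F H : {ffun I -> E} -> 'I_m -> R) (C D : R) (e0 : E) : (0 < m)%N ->
  (forall eps k, \sum_eta F (upd eps (blk k) eta) k <=
    m%:R / 2 * \sum_eta H (upd eps (blk k) eta) k + #|E|%:R * D) ->
  (forall eps, \sum_k H eps k <= 1) -> (forall eps k, C <= F eps k) ->
  C <= 2^-1 + D.
Proof.
move=> m0 step H1 CF; have mR : 0 < m%:R :> R by rewrite ltr0n.
set N : R := #|E|%:R in step.
have N0 : 0 < N by rewrite ltr0n; apply/card_gt0P; exists e0.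
pose M : R := #|{ffun I -> E}|%:R.
have M0 : 0 < M by rewrite ltr0n; apply/card_gt0P; exists [ffun=> e0].
have stepk k : N * \sum_eps F eps k <=
    m%:R / 2 * (N * \sum_eps H eps k) + M * (N * D).
  rewrite -(sum_resample _ (blk k) (F ^~ k)) -(sum_resample _ (blk k) (H ^~ k)).
  rewrite /M [X in _ + X]mulr_natl -sumr_const mulr_sumr -big_split /=.
  by apply: ler_sum => eps _; exact: step.
have HM : \sum_k \sum_eps H eps k <= M.
  rewrite exchange_big /= /M -[leRHS]mulr1 mulr_natl -sumr_const.
  by apply: ler_sum => eps _; exact: H1.
have FM : m%:R * (M * C) <= \sum_k \sum_eps F eps k.
  rewrite -[X in X%:R * _]card_ord mulr_natl -sumr_const; apply: ler_sum => k _.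
  by rewrite /M mulr_natl -sumr_const; apply: ler_sum => eps _; exact: CF.
have total : N * (\sum_k \sum_eps F eps k) <=
    m%:R / 2 * (N * \sum_k \sum_eps H eps k) + m%:R * (M * (N * D)).
  rewrite mulr_sumr; apply: (le_trans (ler_sum _ (fun k _ => stepk k))).
  by rewrite big_split /= sumr_const card_ord -!mulr_sumr [X in _ <= _ + X]mulr_natl.
have mN0 : 0 < N * M * m%:R by rewrite !mulr_gt0.
rewrite -(ler_pM2l mN0).
have -> : N * M * m%:R * C = N * (m%:R * (M * C)) by ring.
apply: (le_trans (ler_wpM2l (ltW N0) FM)); apply: (le_trans total).
rewrite mulrDr; apply: lerD.
  rewrite (_ : N * M * m%:R / 2 = m%:R / 2 * (N * M)); last by ring.
  by rewrite ler_wpM2l ?divr_ge0// ler_wpM2l// ltW.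
by rewrite le_eqVlt; apply/orP; left; apply/eqP; ring.
Qed.

End resample.

(** * The configurations and their separation *)

Section configuration.
Context {R : realType} {n d : nat}.
Variable delta : R.

Lemma block_subproof (i : 'I_n) : (i./2 < n)%N.
Proof.
by rewrite (leq_ltn_trans _ (ltn_ord i))// -{2}(odd_double_half i) -addnn addnA leq_addl.
Qed.
(** Pair labels are taken in ['I_n] so that the last, unpaired index of an odd [n] has a label
    too. *)
Definition block (i : 'I_n) : 'I_n := Ordinal (block_subproof i).

Lemma fst_subproof (k : 'I_(n./2)) : (k.*2 < n)%N.
Proof. by have := ltn_ord k; rewrite -ltn_double => /leq_trans -> //; rewrite -{2}(odd_double_half n) leq_addl. Qed.
Lemma snd_subproof (k : 'I_(n./2)) : (k.*2.+1 < n)%N.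
Proof. have := ltn_ord k; rewrite -leq_double doubleS => /leq_trans -> //; by rewrite -{2}(odd_double_half n) leq_addl. Qed.
Definition fst_of (k : 'I_(n./2)) : 'I_n := Ordinal (fst_subproof k).
Definition snd_of (k : 'I_(n./2)) : 'I_n := Ordinal (snd_subproof k).

Definition config (eps : {ffun 'I_n -> {ffun 'I_d -> bool}}) (i : 'I_n) : 'rV[R]_d :=
  \row_j (delta * (4 * (i./2)%:R + (-1) ^+ i * sg (eps (block i) j))).

(** Pair [k] is collapsed to its midpoint, giving a base point that does not depend on the signs of
    that pair. *)
Definition centred (eps : {ffun 'I_n -> {ffun 'I_d -> bool}}) (k : 'I_(n./2)) (i : 'I_n) : 'rV[R]_d :=
  if i./2 == k then const_mx (delta * (4 * k%:R)) else config eps i.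

Lemma fst_neq_snd k : fst_of k != snd_of k.
Proof. by rewrite -val_eqE /= neq_ltn ltnSn. Qed.

Lemma half_eq (k : 'I_(n./2)) (i : 'I_n) : (i./2 == k) = (i == fst_of k) || (i == snd_of k).
Proof.
rewrite -!val_eqE /= -{2 3}(odd_double_half i).
case: (odd i); rewrite ?add1n ?add0n.
- rewrite eqSS (inj_eq double_inj); case: (i./2 == k); rewrite ?orbT// orbF.
  by apply/esym/eqP => /(congr1 odd); rewrite /= !odd_double.
- rewrite (inj_eq double_inj); case: (i./2 == k) => //=.
  by apply/esym/eqP => /(congr1 odd); rewrite /= !odd_double.
Qed.

Lemma config_upd eps k eta i :
  config (upd eps (block (fst_of k)) eta) i =
  centred eps k i + dipole (fst_of k) (snd_of k) (signs delta eta) i.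
Proof.
apply/rowP => j; rewrite /config /centred /dipole half_eq !mxE ffunE -val_eqE /= doubleK half_eq.
have [->|i1] := eqVneq i (fst_of k).
  by rewrite (negbTE (fst_neq_snd k)) !mxE /= doubleK -signr_odd odd_double expr0; ring.
have [->|i2] := eqVneq i (snd_of k).
  by rewrite !mxE /= uphalf_double -signr_odd /= odd_double expr1; ring.
by rewrite /= !mxE subrr mul0r addr0.
Qed.

(** The midpoint is common to the pair, so the transposition only reverses the deviation. *)
Lemma config_upd_swap eps k eta i :
  config (upd eps (block (fst_of k)) eta) (tperm (fst_of k) (snd_of k) i) =
  centred eps k i + dipole (fst_of k) (snd_of k) (- signs delta eta) i.
Proof.
rewrite config_upd /centred /dipole !half_eq.
case: tpermP => [->|->|/eqP/negbTE i1 /eqP/negbTE i2].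
- by rewrite !eqxx (negbTE (fst_neq_snd k)) eq_sym (negbTE (fst_neq_snd k)) /= !sub0r !subr0 scale1r scaleN1r.
- by rewrite !eqxx (negbTE (fst_neq_snd k)) eq_sym (negbTE (fst_neq_snd k)) /= !sub0r !subr0 scale1r scaleN1r opprK.
- by rewrite i1 i2 subrr !scale0r.
Qed.

Lemma centred_pair eps k : centred eps k (fst_of k) = centred eps k (snd_of k).
Proof. by rewrite /centred /= uphalf_double doubleK eqxx. Qed.

(** Within a pair the signs differ and the gap is 2; between pairs it is at least 4 - 2. *)
Lemma signed_gap (a b : nat) (e f : bool) : ((a == b) ==> (e != f)) ->
  4 <= ((4 * a%:R + sg e) - (4 * b%:R + sg f)) ^+ 2 :> R.
Proof.
have [->|ab _] /= := eqVneq a b; first by case: e; case: f => //= _; rewrite /sg; lra.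
have : (a%:R + 1 <= b%:R :> R) \/ (b%:R + 1 <= a%:R :> R).
  by move: ab; rewrite neq_ltn => /orP[ab|ab]; [left|right]; rewrite natr1 ler_nat.
by case=> h; case: e; case: f; rewrite /sg; nra.
Qed.

Lemma edist_config eps i j : 0 <= delta -> i != j ->
  2 * delta * Num.sqrt d%:R <= Defs.edist (config eps i) (config eps j).
Proof.
move=> delta0 ij; rewrite -[2 * delta]ger0_norm ?mulr_ge0// -sqrtr_sqr -sqrtrM ?sqr_ge0//.
rewrite ler_sqrt ?sumr_ge0//; last by move=> k _; exact: sqr_ge0.
rewrite mulr_natr -[X in _ *+ X]card_ord -sumr_const; apply: ler_sum => k _.
rewrite !mxE -mulrBr !exprMn [leLHS]mulrC ler_wpM2l ?sqr_ge0//.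
(* Absorbing the parity into the sign shows that the two points of a pair carry opposite signs in
   every coordinate. *)
pose sgn (i : 'I_n) := if odd i then ~~ eps (block i) k else eps (block i) k.
have sgnE (l : 'I_n) : (-1) ^+ l * sg (eps (block l) k) = sg (sgn l) :> R.
  by rewrite -signr_odd /sgn; case: (odd l); case: (eps _ _); rewrite /sg /=; ring.
rewrite !sgnE (_ : 2 ^+ 2 = 4); last by ring.
apply: signed_gap; apply/implyP => /eqP ij2.
have bij : block i = block j by apply: val_inj.
have odd_ij : odd i != odd j.
  apply: contraNneq ij => oij; apply/eqP/val_inj.
  by rewrite /= -(odd_double_half i) -(odd_double_half j) oij ij2.
by rewrite /sgn bij; move: odd_ij; case: (odd i); case: (odd j); case: (eps _ _).
Qed.

Lemma sep_dist_config eps : 0 <= delta -> (1 < n)%N ->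
  2 * delta * Num.sqrt d%:R <= sep_dist (config eps).
Proof.
move=> delta0 n1; apply: lb_le_inf.
  exists (Defs.edist (config eps (Ordinal (ltnW n1))) (config eps (Ordinal n1))).
  by exists (Ordinal (ltnW n1)), (Ordinal n1).
by move=> _ [i [j [ij ->]]]; exact: edist_config.
Qed.

End configuration.

(** * Error probabilities and disjoint decisions *)

Section error_probability.
Context {R : realType} {n d : nat}.
Variables (mu nu : 'I_n -> 'rV[R]_d) (s : R).

Lemma pair_law_indic : exists Q : probability (@Data R n d) R,
  forall A, measurable A -> pair_law mu nu s (EFin \o \1_A) = Q A.
Proof.
have [Q QE] := represented_pair_law mu nu s; exists Q => A mA.
rewrite QE => [| |z]; last by rewrite lee_fin.
- by rewrite integral_indic// setIT.
- by apply/measurable_EFinP; exact: measurable_indic.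
Qed.

Lemma pair_law_indicC (A : set (@Data R n d)) (C : R) : measurable A ->
  (pair_law mu nu s (EFin \o \1_(~` A)) <= C%:E)%E ->
  1 - C <= fine (pair_law mu nu s (EFin \o \1_A)).
Proof.
move=> mA; have [Q QE] := pair_law_indic.
rewrite !QE//; last exact: measurableC.
rewrite probability_setC// -[Q A]fineK ?fin_num_measure// -EFinB lee_fin fineK ?fin_num_measure//.
by lra.
Qed.

Lemma sum_pair_law_disjoint N (A : 'I_N -> set (@Data R n d)) :
  (forall j, measurable (A j)) -> trivIset setT A ->
  \sum_j fine (pair_law mu nu s (EFin \o \1_(A j))) <= 1.
Proof.
move=> mA tA; have [Q QE] := pair_law_indic.
rewrite (eq_bigr (fun j => fine (Q (A j)))) => [|j _]; last by rewrite QE.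
rewrite -lee_fin -sumEFin (eq_bigr (fun j => Q (A j))) => [|j _]; last first.
  by rewrite fineK// fin_num_measure.
rewrite -(measure_bigsetU_ord Q xpredT mA tA); apply: probability_le1.
exact: bigsetU_measurable.
Qed.

End error_probability.

(** * Comparing the swaps with the identity on average *)

Section averaging.
Context {R : realType} {n d : nat}.
Variables (s delta : R) (est : @Data R n d -> {perm 'I_n}).
Hypotheses (s0 : s != 0) (mest : estimator est) (m0 : (0 < n./2)%N).

Definition swap (k : 'I_(n./2)) : {perm 'I_n} := tperm (fst_of k) (snd_of k).

Lemma swap_inj : injective swap.
Proof.
move=> k l kl; apply: val_inj; apply: double_inj.
have := congr1 (fun p : {perm 'I_n} => p (fst_of k)) kl.
rewrite /swap tpermL; case: tpermP => [e _|e _|_ _ e].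
- exact: (congr1 val e).
- by move/(congr1 (fun i : 'I_n => odd i)): e; rewrite /= !odd_double.
- by have := fst_neq_snd k; rewrite e eqxx.
Qed.

Definition decide (k : 'I_(n./2)) : set (@Data R n d) := est @^-1` [set swap k].

Lemma measurable_decide k : measurable (decide k).
Proof. exact: mest. Qed.

Lemma trivIset_decide : trivIset setT decide.
Proof. by move=> k l _ _ [z [/= zk zl]]; apply: swap_inj; rewrite -zk -zl. Qed.

Let beta := 2 * delta ^+ 2 / s ^+ 2.

(** [block_bound] with t = n / 2 provides the resampling inequality. Under the identity the events
    [decide k] are disjoint, so their probabilities sum to at most 1 for each configuration. *)
Lemma averaging (J : finType) (c a b : J -> R) (C : R) :
  (forall x y : R, coshR x ^+ 2 <= coshR y * \sum_j c j * expR (a j * x + b j * y)) ->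
  (forall eps k, 1 - C <= fine (pair_law (config delta eps)
     (config delta eps \o swap k) s (EFin \o \1_(decide k)))) ->
  1 - C <= 2^-1 + (expR (- beta) * \sum_j c j * expR (beta * (a j ^+ 2 + b j ^+ 2))) ^+ d /
     (2 * (n./2)%:R).
Proof.
move=> hc hC; set m := n./2.
have mR : 0 < m%:R :> R by rewrite ltr0n.
pose pswap eps k := fine (pair_law (config delta eps)
  (config delta eps \o swap k) s (EFin \o \1_(decide k))).
pose pid eps k := fine (pair_law (config delta eps) (config delta eps) s
  (EFin \o \1_(decide k))).
apply: (resampling_average _ _ (fun k => block (fst_of k)) pswap pid _ _ [ffun=> true]) => //.
- move=> eps k.
  have eq_law mu mu' nu nu' (F : @Data R n d -> \bar R) : mu = mu' -> nu = nu' ->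
      fine (pair_law mu nu s F) = fine (pair_law mu' nu' s F) by move=> -> ->.
  have cE eta : config delta (upd eps (block (fst_of k)) eta) =
      (fun i => centred delta eps k i + dipole (fst_of k) (snd_of k) (signs delta eta) i).
    by apply/funext => i; exact: config_upd.
  have sE eta : config delta (upd eps (block (fst_of k)) eta) \o swap k =
      (fun i => centred delta eps k i + dipole (fst_of k) (snd_of k) (- signs delta eta) i).
    by apply/funext => i; exact: config_upd_swap.
  have subst_le (x x' y y' e f : R) : x = x' -> y = y' -> x' <= e * y' + f -> x <= e * y + f.
    by move=> -> ->.
  have NE : #|{ffun 'I_d -> bool}|%:R = 2 ^+ d :> R.
    by rewrite card_ffun card_bool card_ord natrX.
  rewrite NE; apply: (subst_le _ _ _ _ _ _
    (eq_bigr _ (fun eta _ => eq_law _ _ _ _ _ (cE eta) (sE eta)))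
    (eq_bigr _ (fun eta _ => eq_law _ _ _ _ _ (cE eta) (cE eta)))).
  exact: (@block_bound R n d s delta (centred delta eps k) (fst_of k) (snd_of k) s0
    (fst_neq_snd k) (centred_pair delta eps k) J c a b (decide k) m%:R hc
    (measurable_decide k) mR).
- move=> eps; apply: sum_pair_law_disjoint; first exact: measurable_decide.
  exact: trivIset_decide.
Qed.

End averaging.

(** * Numerical bounds *)

Lemma coshR_sq_expand (R : realType) (x : R) :
  coshR x ^+ 2 = \sum_(e : bool * bool) 4^-1 * expR ((sg e.1 + sg e.2) * x).
Proof.
rewrite -(pair_bigA _ (fun e f => 4^-1 * expR ((sg e + sg f) * x))) /= !big_bool /=.
rewrite !mulrDl !mul1r !mulN1r !expRD /coshR; by field.
Qed.

(** It suffices to dominate 1 / cosh y: the factor cosh^2 x is itself a sum of exponentials, with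
    expectation (1 + e^(4 beta)) / 2. *)
Lemma dominating_family (R : realType) (K : finType) (w b : K -> R) :
  (forall y, 1 <= coshR y * \sum_k w k * expR (b k * y)) ->
  exists (J : finType) (c a b' : J -> R),
    (forall x y, coshR x ^+ 2 <= coshR y * \sum_j c j * expR (a j * x + b' j * y)) /\
    (forall beta, expR (- beta) * \sum_j c j * expR (beta * (a j ^+ 2 + b' j ^+ 2)) =
       expR (- beta) * ((1 + expR beta ^+ 4) / 2) * \sum_k w k * expR (beta * b k ^+ 2)).
Proof.
move=> hw; exists (bool * bool * K)%type, (fun j => 4^-1 * w j.2),
  (fun j => sg j.1.1 + sg j.1.2), (fun j => b j.2); split=> [x y|beta].
  rewrite -(pair_bigA _ (fun e k => 4^-1 * w k * expR ((sg e.1 + sg e.2) * x + b k * y))) /=.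
  rewrite (_ : \sum_i _ = coshR x ^+ 2 * \sum_k w k * expR (b k * y)).
    by rewrite mulrCA ler_peMr ?sqr_ge0.
  rewrite coshR_sq_expand big_distrlr /=; apply: eq_bigr => e _; apply: eq_bigr => k _.
  by rewrite expRD; ring.
rewrite -mulrA; congr (_ * _).
rewrite -(pair_bigA _ (fun e k => 4^-1 * w k * expR (beta * ((sg e.1 + sg e.2) ^+ 2 + b k ^+ 2)))) /=.
rewrite (_ : (1 + _) / 2 = \sum_(e : bool * bool) 4^-1 * expR (beta * (sg e.1 + sg e.2) ^+ 2)).
  rewrite big_distrlr /=; apply: eq_bigr => e _; apply: eq_bigr => k _.
  by rewrite mulrDr expRD; ring.
rewrite -(pair_bigA _ (fun e f => 4^-1 * expR (beta * (sg e + sg f) ^+ 2))) /= !big_bool /=.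
rewrite subrr addNr expr0n /= !mulr0 !expR0 -expRM_natr.
have -> : beta * (1 + 1) ^+ 2 = beta * 4%:R by ring.
have -> : beta * (-1 - 1) ^+ 2 = beta * 4%:R by ring.
by move: (expR _) => z; field.
Qed.

(** Uses 1 / cosh y <= 1, and then 1 + e^(4 beta) <= 2 e^(4 beta). *)
Lemma dominating_family_crude (R : realType) (beta : R) : 0 <= beta ->
  exists (J : finType) (c a b : J -> R),
    (forall x y, coshR x ^+ 2 <= coshR y * \sum_j c j * expR (a j * x + b j * y)) /\
    0 <= expR (- beta) * \sum_j c j * expR (beta * (a j ^+ 2 + b j ^+ 2)) <= expR (3 * beta).
Proof.
move=> b0; have [|J [c [a [b [hc hG]]]]] := @dominating_family R unit (fun=> 1) (fun=> 0).
  by move=> y; rewrite big_const card_unit /= mul0r expR0 addr0 !mulr1; exact: coshR_ge1.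
exists J, c, a, b; split=> //; rewrite hG big_const card_unit /= expr0n /= mulr0 expR0 addr0 !mulr1.
have y1 : 1 <= expR beta by rewrite -expR0 ler_expR.
have y0 : 0 < expR beta by exact: expR_gt0.
rewrite (_ : 3 * beta = beta * 3%:R); last by rewrite mulrC.
rewrite expRM_natr expRN; set y := expR beta in y1 y0 *; apply/andP; split.
  by rewrite mulr_ge0 ?invr_ge0 ?divr_ge0 ?addr_ge0 ?exprn_ge0// ltW.
rewrite mulrC ler_pdivrMr// -exprSr ler_pdivrMr//.
by have := exprn_ege1 4 y1; lra.
Qed.

(* [1 / C <= 3 - 3 C + C^2] for [C >= 1], because [(C - 1)^3 >= 0]; with
   [C = cosh v] the expectation of the right-hand side still is [1 - b + O(b^2)]. *)
Lemma dominating_family_fine (R : realType) (beta : R) : 0 <= beta <= 64^-1 ->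
  exists (J : finType) (c a b : J -> R),
    (forall x y, coshR x ^+ 2 <= coshR y * \sum_j c j * expR (a j * x + b j * y)) /\
    0 <= expR (- beta) * \sum_j c j * expR (beta * (a j ^+ 2 + b j ^+ 2)) <= expR (40 * beta ^+ 2).
Proof.
move=> /andP[b0 b1].
(* The coefficients and frequencies of 3 - 3 cosh y + cosh^2 y written in exponentials. *)
pose w : 'I_5 -> R := fun i => [:: 7/2; - (3/2); - (3/2); 4^-1; 4^-1]`_i.
pose q : 'I_5 -> R := fun i => [:: 0; 1; -1; 2; -2]`_i.
have [y|J [c [a [b [hc hG]]]]] := @dominating_family R _ w q.
  rewrite !big_ord_recl big_ord0 /w /q /=.
  have C1 := coshR_ge1 _ y.
  have -> : -2 * y = - (2%:R * y) by ring.
  rewrite mul0r expR0 mul1r mulN1r !expRN expRM_natl.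
  have e0 := expR_gt0 y.
  rewrite (_ : _ + _ = 3 - 3 * coshR y + coshR y ^+ 2); last first.
    by rewrite /coshR expRN; field; rewrite gt_eqF.
  have : 0 <= (coshR y - 1) ^+ 3 by rewrite exprn_ge0// subr_ge0.
  by move: (coshR y) => C; rewrite -subr_ge0 => /le_trans; apply; rewrite le_eqVlt; apply/orP; left; apply/eqP; ring.
exists J, c, a, b; split=> //; rewrite hG !big_ord_recl big_ord0 /w /q /=.
have h0 : 0 <= expR beta - 1 by rewrite subr_ge0 -expR0 ler_expR.
have h1 : expR beta - 1 <= 2 * beta.
  have eV : 1 - beta <= (expR beta)^-1 by rewrite -expRN; exact: expR_ge1Dx.
  have b2 : 0 < 1 - beta by lra.
  have : expR beta <= (1 - beta)^-1.
    by rewrite -[expR beta]invrK lef_pV2// posrE invr_gt0 expR_gt0.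
  move=> /le_trans le1; rewrite lerBlDr; apply: le1.
  by rewrite -[leLHS]mul1r ler_pdivrMr//; nra.
have h2 : (expR beta - 1) <= 32^-1 by lra.
have -> : beta * 0 ^+ 2 = 0 by ring.
have -> : beta * 1 ^+ 2 = beta by ring.
have -> : beta * (-1) ^+ 2 = beta by ring.
have -> : beta * 2 ^+ 2 = beta * 4%:R by ring.
have -> : beta * (-2) ^+ 2 = beta * 4%:R by ring.
rewrite expR0 expRM_natr expRN.
set h := expR beta - 1 in h0 h1 h2.
rewrite (_ : expR beta = 1 + h); last by rewrite /h; ring.
have hh : 0 < 1 + h by lra.
set T := (X in _ * _ * X).
have TE : T = (7 - 6 * (1 + h) + (1 + h) ^+ 4) / 2 by rewrite /T; field.
rewrite TE; apply/andP; split.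
  have p4 : 1 <= (1 + h) ^+ 4 by rewrite exprn_ege1// lerDl.
  apply: mulr_ge0; last by lra.
  by rewrite mulr_ge0 ?invr_ge0 ?(ltW hh)//; lra.
apply: (le_trans _ (expR_ge1Dx _)).
rewrite -[_^-1 * _ * _]mulrA mulrC ler_pdivrMr//.
(* From h <= 2 beta, 10 h^2 is at most 40 beta^2. *)
apply: (@le_trans _ _ ((1 + 10 * h ^+ 2) * (1 + h))); last first.
  by rewrite ler_wpM2r ?(ltW hh)//; nra.
(* The constant and linear terms in [h] cancel. As powers of [h] are at most h <= 1/32, the negative
   terms in the bracket total at most 135/32, below 24. *)
rewrite -subr_ge0 (_ : _ - _ = 4^-1 * (h ^+ 2 * (24 + 12 * h - 48 * h ^+ 2 - 50 * h ^+ 3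
  - 28 * h ^+ 4 - 8 * h ^+ 5 - h ^+ 6))); last by field.
have hX k : h ^+ k.+1 <= h by rewrite exprS ler_piMr// exprn_ile1//; lra.
rewrite mulr_ge0// mulr_ge0 ?sqr_ge0//.
have := (hX 1%N, hX 2%N, hX 3%N, hX 4%N, hX 5%N) => -[[[[x2 x3] x4] x5] x6].
by lra.
Qed.

(** The choice of [delta] gives beta = z^2 / (64 d), and the exponent summed over the [d]
    coordinates must not exceed (ln n) / 2. The fine bound yields (40/4096) ln n, the crude one
    (3/64) ln n. The factor [1] in [kappa] is the constant [c] of the theorem. *)
Lemma chi2_budget (R : realType) (n d : nat) (sigma : R) : (1 < n)%N -> (0 < d)%N -> 0 < sigma ->
  let kappa := 2 `^ (- (5 / 2)) * sigma *
     Num.max (Num.sqrt (ln n%:R)) ((1 * d%:R * ln n%:R) `^ (4^-1)) in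
  exists (delta : R), [/\ 0 <= delta, 2 * delta * Num.sqrt d%:R = kappa &
  exists (J : finType) (c a b : J -> R),
    (forall x y, coshR x ^+ 2 <= coshR y * \sum_j c j * expR (a j * x + b j * y)) /\
    (expR (- (2 * delta ^+ 2 / sigma ^+ 2)) * \sum_j c j *
       expR (2 * delta ^+ 2 / sigma ^+ 2 * (a j ^+ 2 + b j ^+ 2))) ^+ d <= Num.sqrt n%:R].
Proof.
move=> n1 d1 s0; set L := ln n%:R.
have n0 : 0 < n%:R :> R by rewrite ltr0n (ltn_trans _ n1).
have dR : 0 < d%:R :> R by rewrite ltr0n.
have L0 : 0 < L by rewrite ln_gt0// ltr1n.
have sqrtn : expR (L / 2) = Num.sqrt n%:R.
  by rewrite -powR12_sqrt ?ltW// /powR gt_eqF// mulrC.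
set x := Num.sqrt L; set y := _ `^ 4^-1.
have x2 : x ^+ 2 = L by rewrite sqr_sqrtr// ltW.
have y4 : y ^+ 4 = d%:R * L.
  rewrite -powR_mulrn ?powR_ge0// -powRrM mulVf ?powRr1 ?mul1r// ?mulr_ge0// ltW//.
have x0 : 0 <= x by exact: sqrtr_ge0.
have y0 : 0 <= y by exact: powR_ge0.
set p := 2 `^ _.
have p0 : 0 <= p by exact: powR_ge0.
have p2 : p ^+ 2 = 32^-1.
  rewrite -powR_mulrn// -powRrM (_ : - (5 / 2) * 2%:R = - 5%:R); last by field.
  by rewrite powRN powR_mulrn//; congr (_^-1); ring.
set z := Num.max x y; have z0 : 0 <= z by rewrite le_max x0.
move=> kappa.
have sd0 : 0 < Num.sqrt d%:R :> R by rewrite sqrtr_gt0.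
exists (kappa / (2 * Num.sqrt d%:R)); split.
- by rewrite divr_ge0// ?mulr_ge0// ltW.
- by field; rewrite gt_eqF.
set beta := _ / sigma ^+ 2.
have betaE : beta = z ^+ 2 / (64 * d%:R).
  rewrite /beta /kappa !exprMn p2 exprVn exprMn sqr_sqrtr ?ltW//.
  by field; rewrite !gt_eqF.
have beta0 : 0 <= beta by rewrite betaE divr_ge0 ?sqr_ge0// mulr_ge0// ltW.
have expd K : K * d%:R <= L / 2 -> expR K ^+ d <= Num.sqrt n%:R.
  by move=> hK; rewrite -expRM_natr -sqrtn ler_expR.
rewrite -sqrtn; have [xy|yx] := leP x y.
- have zE : z = y by rewrite /z; apply/max_idPr.
  (* Here L^2 <= d L, so ln n <= d; then y^2 <= d, which puts beta in the range of the fine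
     bound. *)
  have Ld : L <= d%:R.
    have : x ^+ 4 <= y ^+ 4 by rewrite ler_pXn2r.
    by rewrite y4 (_ : x ^+ 4 = L * L) ?ler_pM2r// -x2; ring.
  have y2d : y ^+ 2 <= d%:R.
    rewrite -(@ler_pXn2r _ 2)// ?nnegrE ?sqr_ge0 ?(ltW dR)// -exprM y4.
    by rewrite expr2 ler_pM2l.
  have betas : 0 <= beta <= 64^-1.
    rewrite beta0 betaE zE /= ler_pdivrMr ?mulr_gt0//.
    by rewrite mulrA mulVf// mul1r.
  have [J [c [a [b [hc /andP[G0 G1]]]]]] := dominating_family_fine R beta betas.
  exists J, c, a, b; split=> //; rewrite sqrtn.
  apply: (le_trans (lerXn2r d _ _ G1)); rewrite ?nnegrE ?expR_ge0//.
  apply: expd; rewrite betaE zE.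
  have -> : 40 * (y ^+ 2 / (64 * d%:R)) ^+ 2 * d%:R = 40 / 4096 * (y ^+ 4 / d%:R).
    by field; rewrite gt_eqF.
  by rewrite y4 [_ / d%:R]mulrAC divff ?gt_eqF// mul1r; lra.
- have zE : z = x by rewrite /z; apply/max_idPl/ltW.
  have [J [c [a [b [hc /andP[G0 G1]]]]]] := dominating_family_crude R beta beta0.
  exists J, c, a, b; split=> //; rewrite sqrtn.
  apply: (le_trans (lerXn2r d _ _ G1)); rewrite ?nnegrE ?expR_ge0//.
  apply: expd; rewrite betaE zE x2.
  have -> : 3 * (L / (64 * d%:R)) * d%:R = 3 / 64 * L by field; rewrite gt_eqF.
  lra.
Qed.

(** With m = n / 2 rounded down, n <= 2 m + 1 <= 0.81 m^2 as soon as m >= 3, which is where n >= 6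
    enters. *)
Lemma sqrt_le_half (R : realType) (n : nat) : (6 <= n)%N ->
  Num.sqrt n%:R <= 9 / 10 * (n./2)%:R :> R.
Proof.
move=> n6; rewrite -[leRHS]ger0_norm ?mulr_ge0// -sqrtr_sqr ler_sqrt ?sqr_ge0//.
have m3 : 3 <= (n./2)%:R :> R by rewrite ler_nat (half_leq n6).
have : n%:R <= 2 * (n./2)%:R + 1 :> R.
  by rewrite -natrM natr1 ler_nat mul2n -[leqLHS]odd_double_half -addn1 addnC leq_add2l; case: odd.
by move: (n./2)%:R m3 => m m3 hn; apply: (le_trans hn); nra.
Qed.

(** * The lower bound on the minimax risk *)

Theorem theorem2 (R : realType) :
  exists c C : R, 0 < c /\ 0 < C /\
  forall (n d : nat) (sigma : R), (6 <= n)%N -> (1 <= d)%N -> 0 < sigma ->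
  let kappa := 2 `^ (- (5 / 2)) * sigma *
     Num.max (Num.sqrt (ln n%:R)) ((c * d%:R * ln n%:R) `^ (4^-1)) in
  (C%:E <
   ereal_inf [set r | exists est : Data n d -> {perm 'I_n}, estimator est /\
     r = ereal_sup [set r' | exists pi : {perm 'I_n},
       r' = ereal_sup [set p | exists theta : 'I_n -> 'rV[R]_d,
              (kappa <= sep_dist theta)%R /\
              p = prob_err theta (fun _ => sigma) pi est]]])%E.
Proof.
exists 1, 100^-1; split=> //; split=> // n d sigma n6 d1 sigma0.
lazy zeta; set kappa := _ * Num.max _ _.
(* A strict bound on the infimum needs a margin: each estimator is shown to have risk at least
   1/50. *)
apply: (@lt_le_trans _ _ (50^-1)%:E); first by rewrite lte_fin; lra.
apply: le_ereal_inf_tmp => _ [est [mest ->]]; rewrite leNgt; apply/negP => sup_lt.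
have n1 : (1 < n)%N by exact: leq_trans n6.
have [delta [delta0 kappaE [J [c [a [b [hc hG]]]]]]] := chi2_budget R n d sigma n1 d1 sigma0.
have m3 : (3 <= n./2)%N by exact: half_leq n6.
have m0 : (0 < n./2)%N by exact: leq_trans m3.
have s0 : sigma != 0 by rewrite gt_eqF.
have err eps k : 1 - 50^-1 <= fine (pair_law (config delta eps)
    (config delta eps \o swap k) sigma (EFin \o \1_(decide est k))).
  apply: pair_law_indicC; first exact: measurable_decide.
  apply: le_trans (ltW sup_lt).
  apply: le_ereal_sup_tmp; eexists; first by exists (swap k).
  apply: ereal_sup_ubound; exists (config delta eps).
  split; first by rewrite /kappa -kappaE sep_dist_config.
  (* The error event for the permutation [swap k] is the complement of [decide est k]. *)
  apply: (congr1 (pair_law _ _ _)); apply/funext => z /=.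
  rewrite indicE; congr ((nat_of_bool _)%:R%:E); apply/idP/idP; rewrite inE /=.
  - by move=> /eqP.
  - by move=> /eqP.
have := averaging sigma delta est s0 mest m0 J c a b _ hc err.
have := sqrt_le_half R n n6.
have mR : 3 <= (n./2)%:R :> R by rewrite ler_nat.
set G := (_ * _) ^+ d in hG *.
move: (n./2)%:R mR => m mR hn.
(* The averaged bound reads 49/50 <= 1/2 + sqrt n / (2 m) <= 1/2 + 9/20 = 19/20, a contradiction. *)
rewrite -lerBlDl ler_pdivlMr//; last by lra.
move=> hm; have := le_trans hG hn; lra.
Qed.
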